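(* Let $\mathbb F$ be $\mathbb R$ or $\mathbb C$, and let $I,K,R$ be positive integers such that $4\leq I<R\leq K$ and $R\leq \frac{I^2-I}{2}$. Then the SFS-CPD of an $I\times I\times K$ SFS-tensor of SFS-rank $R$ (over $\mathbb F$) is generically unique.
   Context: An SFS-tensor is a tensor $\mathcal T=(t_{ijk})\in\mathbb F^{I\times I\times K}$ whose frontal slices $(t_{ijk})_{i,j}$ are symmetric matrices for every $k$. A rank-1 SFS-tensor is one of the form $\mathbf a\circ\mathbf a\circ\mathbf c$ with nonzero $\mathbf a\in\mathbb F^I$, $\mathbf c\in\mathbb F^K$, where $\circ$ is the outer product, i.e. its entries are $a_ia_jc_k$. For $\mathbf A=[\mathbf a_1\ \dots\ \mathbf a_R]\in\mathbb F^{I\times R}$ and $\mathbf C=[\mathbf c_1\ \dots\ \mathbf c_R]\in\mathbb F^{K\times R}$ write $[\mathbf A,\mathbf A,\mathbf C]_R=\sum_{r=1}^R\mathbf a_r\circ\mathbf a_r\circ\mathbf c_r$. The SFS-rank of an SFS-tensor $\mathcal T$ is the minimal number of rank-1 SFS-tensors (over $\mathbb F$) whose sum is $\mathcal T$; a decomposition of $\mathcal T$ into this minimal number of rank-1 SFS-terms is called an SFS-CPD of $\mathcal T$. The SFS-CPD of $\mathcal T$ is unique if it is only subject to permutation of the rank-1 terms and to rescaling of the vectors within a rank-1 term that leaves the term unchanged (i.e. the collection of rank-1 SFS-terms is uniquely determined up to order). Let $\mu_{\mathbb F}$ be the Lebesgue measure on $\mathbb F^{I\times R}\times\mathbb F^{K\times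 R}$. The SFS-CPD of an $I\times I\times K$ tensor of SFS-rank $R$ is generically unique if $$\mu_{\mathbb F}\{(\mathbf A,\mathbf C):\ \text{the SFS-CPD of the tensor } [\mathbf A,\mathbf A,\mathbf C]_R \text{ is not unique}\}=0.$$ *)

(* Defs.v *)
From HB Require Import structures.
From mathcomp Require Import all_boot all_order all_algebra.
From mathcomp Require Import complex.
From mathcomp Require Import all_classical all_reals all_analysis.

Set Implicit Arguments.
Unset Strict Implicit.
Unset Printing Implicit Defensive.

Import Order.TTheory GRing.Theory Num.Theory.
Local Open Scope classical_set_scope.
Local Open Scope ring_scope.

(* An I x I x K tensor (t_ijk) is the family of its K frontal slices: t_ijk is
   T k i j. *)
Notation tensor F I K := {ffun 'I_K -> 'M[F]_I}.

Section SFS.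
Variables (F : fieldType) (I K : nat).
Implicit Types (T : tensor F I K) (s : seq (tensor F I K)).

Definition outer (a b : 'cV[F]_I) (c : 'cV[F]_K) : tensor F I K :=
  [ffun k => \matrix_(i, j) (a i 0 * b j 0 * c k 0)].

Definition cpd R (A B : 'M[F]_(I, R)) (C : 'M[F]_(K, R)) : tensor F I K :=
  \sum_(r < R) outer (col r A) (col r B) (col r C).

Definition is_SFS T := forall k, (T k)^T = T k.

Definition is_rank1_SFS T :=
  exists a c, [/\ a != 0, c != 0 & T = outer a a c].

Definition SFS_decomposition T s :=
  (forall t, t \in s -> is_rank1_SFS t) /\ T = \sum_(t <- s) t.

Definition SFS_rank_is T r :=
  (exists2 s, SFS_decomposition T s & size s = r) /\
  (forall s, SFS_decomposition T s -> (r <= size s)%N).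

Definition SFS_CPD T s := SFS_decomposition T s /\ SFS_rank_is T (size s).

(* The terms are compared as tensors, so rescaling the vectors inside a term
   without changing the term plays no role, and perm_eq is equality of
   multisets. *)
Definition SFS_CPD_unique T :=
  exists2 s, SFS_CPD T s & forall s', SFS_CPD T s' -> perm_eq s s'.

Lemma cpd_SFS R (A : 'M[F]_(I, R)) (C : 'M[F]_(K, R)) : is_SFS (cpd A A C).
Proof.
move=> k; apply/matrixP => i j; rewrite /cpd mxE !sum_ffunE !summxE.
by apply: eq_bigr => r _; rewrite !ffunE !mxE [X in X * _]mulrC.
Qed.

End SFS.

Section tuple_measure.
Context d (T : measurableType d) (R : realType).
Local Open Scope ereal_scope.

(* The n-fold product mu \x ... \x mu, carried to n.-tuple T by the bijection
   (x, t) |-> x :: t of T * (n.-1).-tuple T with n.-tuple T. *)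
Fixpoint tuple_measure (mu : set T -> \bar R) n : set (n.-tuple T) -> \bar R :=
  match n with
  | 0 => dirac [tuple]
  | m.+1 => pushforward (mu \x @tuple_measure mu m)
              (fun p : T * m.-tuple T => [tuple of p.1 :: p.2])
  end.

End tuple_measure.
Arguments tuple_measure {d T R} mu n _.

(* The scalars of F are given by real coordinates: a measurable type T, a
   measure mu on T and a bijection f : T -> F.  Below (T, mu, f) is
   (R, Lebesgue, id) for F = R, and (R * R, Lebesgue, (x, y) |-> x +i* y) for
   F = R[i]. *)
Section generic.
Context d (T : measurableType d) (R : realType) (F : fieldType).
Variables (mu : set T -> \bar R) (f : T -> F).

Definition mx_of_tuple m n (t : (m * n).-tuple T) : 'M[F]_(m, n) :=
  \matrix_(i, j) f (tnth t (mxvec_index i j)).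

(* Null set for the Lebesgue measure on F^(m1 x n1) x F^(m2 x n2): S is
   contained in a measurable set of measure 0 for the product measure, which
   amounts to measure 0 for the completion of that measure. *)
Definition mx2_null m1 n1 m2 n2 (S : set ('M[F]_(m1, n1) * 'M[F]_(m2, n2))) :=
  (tuple_measure mu (m1 * n1) \x tuple_measure mu (m2 * n2))%E.-negligible
    [set t | S (mx_of_tuple t.1, mx_of_tuple t.2)].

Definition SFS_CPD_generically_unique_for I K Rk :=
  mx2_null [set AC : 'M[F]_(I, Rk) * 'M[F]_(K, Rk) |
             ~ SFS_CPD_unique (cpd AC.1 AC.1 AC.2)].

End generic.

Definition SFS_CPD_generically_unique_real (R : realType) (I K Rk : nat) :=
  SFS_CPD_generically_unique_for
    (@lebesgue_measure R) (fun x => x : R) I K Rk.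

Definition SFS_CPD_generically_unique_complex (R : realType) (I K Rk : nat) :=
  SFS_CPD_generically_unique_for
    (@lebesgue_measure R \x @lebesgue_measure R)%E
    (fun z => Complex z.1 z.2 : R[i]) I K Rk.

(* Main.v *)
Require Import Defs.
From HB Require Import structures.
From mathcomp Require Import all_boot all_order all_algebra.
From mathcomp Require Import complex.
From mathcomp Require Import all_classical all_reals all_analysis.
From mathcomp Require Import measurable_realfun.

(** Write sq a for the symmetric matrix a *m a^T.  The frontal slices of
cpd A A C are combinations of the matrices sq a_r, where a_r is the column r
of A, and if C has a left inverse then every sq a_r is conversely a
combination of the slices.  So in any other decomposition, with terms
(b_i, b_i, d_i), the matrices sq b_i span all the sq a_r; if the latter are
independent there are at least R terms, and if there are exactly R of them
then both families span the same space.  The decomposition is therefore unique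
as soon as, up to scaling, the sq a_r are independent and are the only
matrices of the form sq b in their span ([SFS_CPD_unique_cpd]).

The second condition says that the quadrics through the points a_r have no
other common zero.  For the maximal number n(n-1)/2 of points it holds in one
remarkable case, the points e_i + e_j with i < j: the quadrics through them
are spanned by the x_i (2 x_i - s), where s is the sum of the coordinates.  At
a common zero, every x_i is 0 or s/2, so that either s = 0 and x = 0, or
exactly two coordinates differ from 0 and they are equal.

To pass from this configuration to almost all of them, the condition has to be
implied by the nonvanishing of a polynomial in A.  The existence of another
common zero b is not of this kind, but a stronger property is: that the ideal
generated by the quadrics through the points contains every form of degree
n+1 vanishing at them.  This is linear algebra in degree n+1.  Its dual form,
[rigid], says that a linear system whose coefficients are polynomials in the
points has no nontrivial solution, so that it persists wherever a certain
determinant does not vanish ([trivial_kernel_open], [rigid_open]); it holds for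
the points e_i + e_j ([rigid_pair_point]) and implies both conditions above
([rigid_indep], [rigid_rank1]).  Fewer than n(n-1)/2 points are completed by
points e_i + e_j to a family of maximal size; both conditions pass to
subfamilies ([generic_squares]).

Finally the zero set of a nonzero polynomial function has measure zero, by
induction on the number of variables: once the last variables are fixed well,
the polynomial in the first one has finitely many roots, and for every other
value of the first variable the induction hypothesis applies
([zero_set_null]). *)

Set Implicit Arguments.
Unset Strict Implicit.
Unset Printing Implicit Defensive.

Import Order.TTheory GRing.Theory Num.Theory.
Local Open Scope ring_scope.

(** * Polynomial functions *)

Section PolynomialFunctions.
Variables (F : comNzRingType) (X J : Type) (x : J -> X -> F).

(** The subalgebra of functions generated by given coordinate functions; the
same definition serves for functions of a matrix and of a tuple, and the only
facts needed are closure properties and restriction to one variable. *)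
Inductive polyfun : (X -> F) -> Prop :=
| polyfun_cst c : polyfun (fun=> c)
| polyfun_coord j : polyfun (x j)
| polyfun_add g h : polyfun g -> polyfun h -> polyfun (fun u => g u + h u)
| polyfun_mul g h : polyfun g -> polyfun h -> polyfun (fun u => g u * h u).

Lemma eq_polyfun g h : g =1 h -> polyfun g -> polyfun h.
Proof. by move=> /funext ->. Qed.

Lemma polyfun_sub g h :
  polyfun g -> polyfun h -> polyfun (fun u => g u - h u).
Proof.
move=> pg ph; apply: (@eq_polyfun (fun u => g u + (-1) * h u)).
  by move=> u; rewrite mulN1r.
exact: polyfun_add pg (polyfun_mul (polyfun_cst _) ph).
Qed.

Lemma polyfun_sum (U : Type) (r : seq U) (P : pred U) (g : U -> X -> F) :
  (forall i, polyfun (g i)) -> polyfun (fun u => \sum_(i <- r | P i) g i u).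
Proof.
move=> pg; elim: r => [|i r IHr].
  by apply: eq_polyfun (polyfun_cst 0) => u; rewrite big_nil.
case Pi: (P i).
  by apply: eq_polyfun (polyfun_add (pg i) IHr) => u; rewrite big_cons Pi.
by apply: eq_polyfun IHr => u; rewrite big_cons Pi.
Qed.

Lemma polyfun_prod (U : Type) (r : seq U) (P : pred U) (g : U -> X -> F) :
  (forall i, polyfun (g i)) -> polyfun (fun u => \prod_(i <- r | P i) g i u).
Proof.
move=> pg; elim: r => [|i r IHr].
  by apply: eq_polyfun (polyfun_cst 1) => u; rewrite big_nil.
case Pi: (P i).
  by apply: eq_polyfun (polyfun_mul (pg i) IHr) => u; rewrite big_cons Pi.
by apply: eq_polyfun IHr => u; rewrite big_cons Pi.
Qed.

Lemma polyfun_mulmx m n p (A : X -> 'M[F]_(m, n)) (B : X -> 'M[F]_(n, p)) :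
  (forall i j, polyfun (fun u => A u i j)) ->
  (forall i j, polyfun (fun u => B u i j)) ->
  forall i j, polyfun (fun u => (A u *m B u) i j).
Proof.
move=> pA pB i j; apply: (@eq_polyfun (fun u => \sum_k A u i k * B u k j)).
  by move=> u; rewrite mxE.
by apply: polyfun_sum => k; apply: polyfun_mul.
Qed.

Lemma polyfun_det n (A : X -> 'M[F]_n) :
  (forall i j, polyfun (fun u => A u i j)) -> polyfun (fun u => \det (A u)).
Proof.
move=> pA; apply: polyfun_sum => s.
by apply: polyfun_mul; [apply: polyfun_cst | apply: polyfun_prod].
Qed.

End PolynomialFunctions.

Lemma polyfun_comp (F : comNzRingType) (X Y J J' : Type) (x : J -> X -> F)
    (y : J' -> Y -> F) (h : Y -> X) (g : X -> F) :
  (forall j, polyfun y (x j \o h)) -> polyfun x g -> polyfun y (g \o h).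
Proof.
move=> ph; elim=> {g} [c|j|g g' _ IHg _ IHg'|g g' _ IHg _ IHg'].
- exact: polyfun_cst.
- exact: ph.
- exact: polyfun_add IHg IHg'.
- exact: polyfun_mul IHg IHg'.
Qed.

(** If the system is nonsingular at u0, its matrix M u0 has a right inverse B,
and det (M u * B) is a polynomial in u which is 1 at u0 and whose
nonvanishing makes the rows of M u independent. *)
Lemma trivial_kernel_open (F : fieldType) (X J : Type) (x : J -> X -> F)
    (U V : finType) (H : X -> U -> V -> F) (u0 : X) :
    (forall i j, polyfun x (fun u => H u i j)) ->
    (forall L : U -> F, (forall j, \sum_i L i * H u0 i j = 0) ->
       forall i, L i = 0) ->
  exists P, [/\ polyfun x P, P u0 != 0 &
    forall u, P u != 0 ->
    forall L : U -> F, (forall j, \sum_i L i * H u i j = 0) ->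
      forall i, L i = 0].
Proof.
move=> pH ker0.
pose M u : 'M[F]_(#|U|, #|V|) := \matrix_(i, j) H u (enum_val i) (enum_val j).
have MP u (L : U -> F) :
    (forall j, \sum_i L i * H u i j = 0) <->
    (\row_i L (enum_val i)) *m M u = 0.
  have E j : ((\row_i L (enum_val i)) *m M u) 0 j
      = \sum_i L i * H u i (enum_val j).
    rewrite mxE (reindex _ (onW_bij _ (enum_val_bij U))) /=.
    by apply: eq_bigr => i _; rewrite !mxE.
  split=> [L0|/rowP L0 j]; first by apply/rowP => j; rewrite E L0 mxE.
  by have := L0 (enum_rank j); rewrite E mxE enum_rankK.
have /row_freeP[B MB] : row_free (M u0).
  apply: inj_row_free => v vM.
  pose L i := v 0 (enum_rank i).
  have vL : v = \row_i L (enum_val i).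
    by apply/rowP => i; rewrite mxE /L enum_valK.
  move: (vM); rewrite vL => /MP /ker0 L0.
  by rewrite -vL; apply/rowP => i; have := L0 (enum_val i);
     rewrite /L enum_valK mxE.
exists (fun u => \det (M u *m B)); split.
- apply: polyfun_det; apply: polyfun_mulmx => i j; last exact: polyfun_cst.
  by apply: (eq_polyfun _ (pH (enum_val i) (enum_val j))) => u; rewrite mxE.
- by rewrite MB det1 oner_eq0.
move=> u Pu L /MP LM i.
have uM : M u *m B \in unitmx by rewrite unitmxE unitfE.
have L0 : \row_i0 L (enum_val i0) = 0 :> 'rV[F]_#|U|.
  by rewrite -[LHS](mulmxK uM) mulmxA LM !mul0mx.
by have /rowP/(_ (enum_rank i)) := L0; rewrite !mxE enum_rankK.
Qed.

(** * Functionals on words *)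

(** The letters Some i and None stand for the linear forms x_i and
s = x_0 + ... + x_e on a space of dimension e+1.  A function f of the words of
length e+2 which is invariant under permutations and additive in s is a linear
functional on the forms of degree e+2; the hypothesis f_diag says that it
vanishes on the multiples of the quadrics x_i (2 x_i - s), and f_init that it
vanishes on the multiples of s^e.  Such a functional is zero. *)

Section WordFunctionals.
Variables (F : numFieldType) (e : nat).
Local Notation letter := (option 'I_e.+1).
Implicit Types (m s : seq letter) (t : seq 'I_e.+1).

Lemma perm_dup (T : eqType) (u : seq T) :
  ~~ uniq u -> exists i u', perm_eq u (i :: i :: u').
Proof.
elim: u => //= i u IHu; rewrite negb_and negbK => /orP[iu|/IHu[j [u' uu']]].
  by exists i, (rem i u); rewrite perm_cons perm_to_rem.
exists j, (i :: u').
rewrite (perm_trans (y := i :: j :: j :: u')) ?perm_cons //.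
by rewrite (perm_catCA [:: i] [:: j; j] u').
Qed.

Lemma perm_letters s :
  perm_eq s (map some (pmap id s) ++ nseq (count_mem None s) None).
Proof.
elim: s => //= -[i|] s IHs /=; first by rewrite perm_cons.
rewrite perm_sym.
by rewrite (perm_catCA (map some _) [:: None]) perm_cons perm_sym.
Qed.

Variable f : seq letter -> F.
Hypothesis f_perm : forall s s', size s = e.+2 -> perm_eq s s' -> f s = f s'.
Hypothesis f_sum : forall m, size m = e.+1 ->
  f (None :: m) = \sum_i f (Some i :: m).
Hypothesis f_diag : forall i m, size m = e ->
  f (Some i :: Some i :: m) *+ 2 = f (Some i :: None :: m).
Hypothesis f_init : forall l l', f (l :: l' :: nseq e None) = 0.

(* The monomial s^(e+2-k) x_t for a sequence t of k indices. *)
Let word t := map some t ++ nseq (e.+2 - size t) None : seq letter.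

Let size_word t : (size t <= e.+2)%N -> size (word t) = e.+2.
Proof. by move=> le_t; rewrite size_cat size_map size_nseq subnKC. Qed.

Let word_small t : (size t <= 2)%N -> f (word t) = 0.
Proof.
case: t => [|i [|j [|//]]] _; rewrite /word /=.
- exact: f_init.
- exact: f_init.
- by rewrite !subSS subn0 f_init.
Qed.

Let word_double i t : (size t <= e)%N ->
  f (word (i :: i :: t)) *+ 2 = f (word (i :: t)).
Proof.
move=> le_t; rewrite /word /= f_diag; last first.
  by rewrite size_cat size_map size_nseq !subSS subnKC.
rewrite !subSS subSn //=; apply: f_perm.
  by rewrite /= size_cat size_map size_nseq subnKC.
by rewrite perm_cons perm_sym (perm_catCA (map some _) [:: None]).
Qed.

(** Descending induction on k, the size of t.  Expanding one factor s of the
monomial as the sum of the x_i, the terms with i outside t vanish by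
induction, and each of the k other ones is half of the initial value.  Hence
2 f = k f, so that f = 0 unless k = 2, where f_init applies.  There is always a
factor s to expand since k <= e+1 < e+2. *)
Let word_uniq t : uniq t -> f (word t) = 0.
Proof.
have [k] := ubnP (e.+1 - size t); elim: k t => // k IHk t lt_k t_uniq.
have [/word_small //|t_gt2] := leqP (size t) 2.
have le_t : (size t <= e.+1)%N.
  by rewrite -(card_uniqP t_uniq) (leq_trans (max_card _)) ?card_ord.
pose m := map some t ++ nseq (e.+1 - size t) None : seq letter.
have fm : f (word t) = f (None :: m).
  apply: f_perm; first by rewrite size_word // leqW.
  by rewrite /word subSn //= (perm_catCA (map some _) [:: None]).
have sz_m : size m = e.+1 by rewrite size_cat size_map size_nseq subnKC.
have in_t i : i \in t -> f (Some i :: m) *+ 2 = f (word t).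
  move=> it; have pt := perm_to_rem it; have sz_t := perm_size pt.
  have le_r : (size (rem i t) <= e)%N by rewrite -ltnS -[X in (X <= _)%N]sz_t.
  rewrite (_ : f (Some i :: m) = f (word (i :: i :: rem i t))).
    rewrite word_double //; apply: f_perm; first by rewrite size_word //= ltnW.
    rewrite /word sz_t /= -cat_cons perm_cat2r -(map_cons some).
    by rewrite perm_map // perm_sym.
  apply: f_perm; first by rewrite /= sz_m.
  rewrite /word /= perm_cons /m sz_t /= !subSS -cat_cons perm_cat2r.
  by rewrite -(map_cons some) perm_map.
have notin_t i : i \notin t -> f (Some i :: m) = 0.
  move=> it; have it_uniq : uniq (i :: t) by rewrite /= it.
  have := IHk (i :: t) _ it_uniq; rewrite /word /= subSS => -> //.
  have := max_card (mem (i :: t)).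
  rewrite (card_uniqP it_uniq) card_ord => le_it.
  by rewrite -ltnS -subSn.
have E : f (word t) *+ 2 = f (word t) *+ size t.
  rewrite {1}fm f_sum // -sumrMnl (bigID [in t]) /= [X in _ + X]big1 ?addr0.
    rewrite (eq_bigr (fun=> f (word t))) => [|i it]; last exact: in_t.
    by rewrite sumr_const (card_uniqP t_uniq).
  by move=> i it; rewrite notin_t // mul0rn.
move/eqP: E; rewrite -(subnK (ltnW t_gt2)) mulrnDr -subr_eq0 opprD addrCA.
by rewrite subrr addr0 oppr_eq0 mulrn_eq0 -leqn0 leqNgt subn_gt0 t_gt2 => /eqP.
Qed.

(** A square x_i^2 is replaced by x_i s / 2, until the indices are distinct. *)
Let word0 t : (size t <= e.+2)%N -> f (word t) = 0.
Proof.
have [k] := ubnP (size t); elim: k t => // k IHk t lt_k le_t.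
have [/word_uniq //|/perm_dup[i [t' tt']]] := boolP (uniq t).
have sz_t := perm_size tt'; rewrite sz_t /= in le_t lt_k.
have -> : f (word t) = f (word (i :: i :: t')).
  apply: f_perm; first by rewrite size_word // sz_t.
  by rewrite /word sz_t perm_cat2r perm_map.
apply/eqP; rewrite -[_ == 0](@mulrn_eq0 _ _ 2) word_double //.
by rewrite IHk //= ltnW.
Qed.

Lemma word_functional_eq0 s : size s = e.+2 -> f s = 0.
Proof.
move=> sz_s; have ps := perm_letters s; rewrite (f_perm sz_s ps).
have := perm_size ps; rewrite sz_s size_cat size_map size_nseq => sz_eq.
have -> : count_mem None s = (e.+2 - size (pmap id s))%N by rewrite sz_eq addKn.
by apply: word0; rewrite sz_eq leq_addr.
Qed.

End WordFunctionals.

(** * Rigid configurations of points *)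

Section Rigidity.
Variables (F : numFieldType) (n e : nat) (Q : finType).
Local Notation letter := (option 'I_n).
Local Notation context := (e.-tuple letter).
Implicit Types (a : Q -> 'cV[F]_n) (b v : 'cV[F]_n) (l : letter).
Implicit Types (L : Q -> context -> F) (w : context).

Definition letter_row l : 'rV[F]_n :=
  if l is Some i then delta_mx 0 i else const_mx 1.

Definition letter_form v l : F := (letter_row l *m v) 0 0.

Lemma letter_form_some v i : letter_form v (Some i) = v i 0.
Proof. by rewrite /letter_form -rowE mxE. Qed.

Lemma letter_form_none v : letter_form v None = \sum_i v i 0.
Proof.
by rewrite /letter_form mxE; apply: eq_bigr => i _; rewrite mxE mul1r.
Qed.

Lemma letter_formM v l l' : letter_form v l * letter_form v l' =
  (letter_row l *m (v *m v^T) *m (letter_row l')^T) 0 0.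
Proof.
rewrite mulmxA -(mulmxA _ v^T) -trmx_mul [RHS]mxE big_ord1.
by congr (_ * _); rewrite mxE.
Qed.

Lemma letter_form_sq (a : Q -> 'cV[F]_n) (c : Q -> F) l l' :
  \sum_q c q * letter_form (a q) l * letter_form (a q) l' =
  (letter_row l *m (\sum_q c q *: (a q *m (a q)^T)) *m (letter_row l')^T) 0 0.
Proof.
rewrite mulmx_sumr mulmx_suml summxE; apply: eq_bigr => q _.
by rewrite -scalemxAr -scalemxAl mxE -mulrA letter_formM.
Qed.

(** For a family L of functions of words of length e, indexed by the points,
this is a function of words of length e+2.  In its first two letters it lies in
the span of the squares of the points, which means that it vanishes on the
multiples of the quadrics through the points.  When it does not depend on the
order of the letters, it is a functional on forms of degree e+2. *)
Definition contraction a L l l' w : F :=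
  \sum_q L q w * letter_form (a q) l * letter_form (a q) l'.

Definition symmetric_contraction a L := forall l1 l1' w1 l2 l2' w2,
  perm_eq (l1 :: l1' :: w1) (l2 :: l2' :: w2) ->
  contraction a L l1 l1' w1 = contraction a L l2 l2' w2.

(** The functionals of degree e+2 vanishing on the multiples of the quadrics
through the points are determined by their coefficients L q s^e, so that they
form a space of dimension at most the number of points.  This is how the
absence of other common zeros is expressed by a linear system. *)
Definition rigid a := forall L, symmetric_contraction a L ->
  (forall q, L q (nseq_tuple e None) = 0) -> forall q w, L q w = 0.

Lemma rigid_open (X J : Type) (x : J -> X -> F) (a : X -> Q -> 'cV[F]_n) u0 :
    (forall q i, polyfun x (fun u => a u q i 0)) -> rigid (a u0) ->
  exists P, [/\ polyfun x P, P u0 != 0 & forall u, P u != 0 -> rigid (a u)].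
Proof.
move=> pa rig0.
pose word_pair := (letter * letter * context)%type.
pose U := (Q * context)%type; pose V := (word_pair * word_pair + Q)%type.
pose word (z : word_pair) : seq letter := z.1.1 :: z.1.2 :: z.2.
pose G u (i : U) (z : word_pair) : F :=
  (i.2 == z.2)%:R * letter_form (a u i.1) z.1.1 * letter_form (a u i.1) z.1.2.
(* One equation for each pair of words, trivial unless they are permutations
   of each other, and one for each point. *)
pose H u (i : U) (j : V) : F := match j with
  | inl z => (perm_eq (word z.1) (word z.2))%:R * (G u i z.1 - G u i z.2)
  | inr q => (i == (q, nseq_tuple e None))%:R
  end.
have GE u (L : U -> F) z : \sum_i L i * G u i z =
    contraction (a u) (fun q w => L (q, w)) z.1.1 z.1.2 z.2.
  rewrite /contraction (eq_bigr (fun i => L (i.1, i.2) * G u (i.1, i.2) z)).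
    rewrite -(pair_bigA _ (fun q w => L (q, w) * G u (q, w) z)) /=.
    apply: eq_bigr => q _; rewrite (bigD1 z.2) //= big1 ?addr0 => [|w ne_w].
      by rewrite /G /= eqxx mul1r mulrA.
    by rewrite /G /= (negPf ne_w) !mul0r mulr0.
  by move=> [].
have HP u (L : U -> F) : (forall j, \sum_i L i * H u i j = 0) <->
    symmetric_contraction (a u) (fun q w => L (q, w)) /\
    (forall q, L (q, nseq_tuple e None) = 0).
  have Hr q : \sum_i L i * H u i (inr q) = L (q, nseq_tuple e None).
    rewrite (bigD1 (q, nseq_tuple e None)) //= eqxx mulr1 big1 ?addr0 //.
    by move=> i /negPf ->; rewrite mulr0.
  have Hl z : \sum_i L i * H u i (inl z) = (perm_eq (word z.1) (word z.2))%:R *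
      (\sum_i L i * G u i z.1 - \sum_i L i * G u i z.2).
    rewrite mulrBr !mulr_sumr -sumrB; apply: eq_bigr => i _ /=.
    by rewrite mulrCA mulrBr mulrBr.
  split=> [L0|[sL L0]].
    split=> [l1 l1' w1 l2 l2' w2 pw|q]; last by rewrite -Hr L0.
    have := L0 (inl ((l1, l1', w1), (l2, l2', w2))).
    by rewrite Hl !GE /word /= pw mul1r => /subr0_eq.
  case=> [[[[l1 l1'] w1] [[l2 l2'] w2]]|q]; last by rewrite Hr.
  rewrite Hl !GE /word /=.
  have [pw|_] := boolP (perm_eq _ _); last by rewrite mul0r.
  by rewrite (sL _ _ _ _ _ _ pw) subrr mulr0.
have plf q l : polyfun x (fun u => letter_form (a u q) l).
  rewrite /letter_form.
  apply: (polyfun_mulmx (A := fun=> letter_row l)) => i j.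
    exact: polyfun_cst.
  by rewrite (ord1 j); apply: pa.
have pG i z : polyfun x (fun u => G u i z).
  apply: polyfun_mul; last exact: plf.
  by apply: polyfun_mul; [apply: polyfun_cst | apply: plf].
have pH i j : polyfun x (fun u => H u i j).
  case: j => [z|q]; last exact: polyfun_cst.
  by apply: polyfun_mul; [apply: polyfun_cst | apply: polyfun_sub].
have ker0 (L : U -> F) :
    (forall j, \sum_i L i * H u0 i j = 0) -> forall i, L i = 0.
  by move=> /HP[sL L0] [q w]; apply: (rig0 (fun q w => L (q, w))).
have [P [pP P0 kerP]] := trivial_kernel_open pH ker0.
exists P; split=> // u Pu L sL L0 q w.
by apply: (kerP u Pu (fun i => L i.1 i.2)  _ (q, w)); apply/HP.
Qed.

Variables (a : Q -> 'cV[F]_n).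
Hypotheses (a_rigid : rigid a) (e_gt0 : (0 < e)%N) (i0 : 'I_n).

(** A relation c between the squares makes the contraction of
L q w = c q * u w vanish for every function u of words; u is chosen
zero at s^e but not everywhere. *)
Lemma rigid_indep (c : Q -> F) :
  \sum_q c q *: (a q *m (a q)^T) = 0 -> forall q, c q = 0.
Proof.
move=> c0 q; pose w0 := nseq_tuple e (Some i0).
have /= := a_rigid (L := fun q w => c q * (w == w0)%:R) _ _ q w0.
rewrite eqxx mulr1; apply.
  suff z l l' w : contraction a (fun q w => c q * (w == w0)%:R) l l' w = 0.
    by move=> *; rewrite !z.
  rewrite /contraction (eq_bigr (fun q => (w == w0)%:R *
      (c q * letter_form (a q) l * letter_form (a q) l'))); last first.
    by move=> r _; rewrite (mulrC (c r)) -!mulrA.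
  by rewrite -mulr_sumr letter_form_sq c0 mulmx0 mul0mx mxE mulr0.
move=> r; rewrite [_ == _](_ : _ = false) ?mulr0 //.
apply/negbTE/eqP => /(congr1 val) /=.
by case: e e_gt0.
Qed.

(* The value at v of the monomial s. *)
Let mono v (s : seq letter) := \prod_(l <- s) letter_form v l.

Let mono_nseq v k l : mono v (nseq k l) = letter_form v l ^+ k.
Proof. by rewrite /mono big_nseq iter_mulr_1. Qed.

Let mono_perm v s s' : perm_eq s s' -> mono v s = mono v s'.
Proof. exact: perm_big. Qed.

(** Otherwise evaluation at the point q would be a nonzero functional with
vanishing coefficients at s^e. *)
Lemma rigid_sum_neq0 q : letter_form (a q) None != 0.
Proof.
apply/eqP => sq0; pose L r (w : context) := (r == q)%:R * mono (a q) w.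
have LE l l' w : contraction a L l l' w = mono (a q) (l :: l' :: w).
  rewrite /contraction (bigD1 q) //= big1 ?addr0 => [|r /negPf ne_rq].
    by rewrite /L eqxx mul1r /mono !big_cons -mulrA mulrC mulrA.
  by rewrite /L ne_rq !mul0r.
have L0 : forall r w, L r w = 0.
  apply: a_rigid => [l1 l1' w1 l2 l2' w2 pw|r].
    by rewrite !LE (mono_perm _ pw).
  by rewrite /L mono_nseq sq0 expr0n eqn0Ngt e_gt0 mulr0.
have aq0 : a q = 0.
  apply/matrixP => i j; rewrite (ord1 j) mxE.
  have /eqP := L0 q (nseq_tuple e (Some i)).
  by rewrite /L eqxx mul1r mono_nseq expf_eq0 letter_form_some => /andP[_ /eqP].
suff /rigid_indep/(_ q)/eqP :
    \sum_r ((r == q)%:R : F) *: (a r *m (a r)^T) = 0 by rewrite eqxx oner_eq0.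
apply: big1 => r _; have [->|_] := eqVneq r q.
  by rewrite aq0 mul0mx scaler0.
by rewrite scale0r.
Qed.

(** Evaluation at b is the contraction of c r * mono b w.  Subtracting
suitable multiples of the evaluations at the points a r cancels the coefficients
at s^e, so by rigidity c q * mono b w is proportional to mono (a q) w
when w varies.  If c q is not zero, comparing the monomials x_i^e and
x_j x_i^(e-1) shows that b and a q are proportional. *)
Lemma rigid_rank1 b (c : Q -> F) :
    b *m b^T = \sum_q c q *: (a q *m (a q)^T) ->
  forall q, c q != 0 -> exists k, b = k *: a q.
Proof.
move=> bE q cq_neq0.
have [->|b_neq0] := eqVneq b 0; first by exists 0; rewrite scale0r.
pose k r := letter_form b None ^+ e / letter_form (a r) None ^+ e.
pose L r (w : context) := c r * (mono b w - k r * mono (a r) w).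
have LE l l' w : contraction a L l l' w =
    mono b (l :: l' :: w) - \sum_r c r * k r * mono (a r) (l :: l' :: w).
  rewrite /mono !big_cons.
  have -> : letter_form b l * (letter_form b l' * mono b w) =
      \sum_r c r * letter_form (a r) l * letter_form (a r) l' * mono b w.
    by rewrite -mulr_suml letter_form_sq -bE -letter_formM mulrA.
  rewrite -sumrB; apply: eq_bigr => r _; rewrite !big_cons /L.
  rewrite mulrBr !mulrBl; congr (_ - _).
    by rewrite -!mulrA; congr (_ * _); rewrite mulrC -mulrA.
  by rewrite -!mulrA [mono (a r) w * _]mulrC -!mulrA.
have L0 : forall r w, L r w = 0.
  apply: a_rigid => [l1 l1' w1 l2 l2' w2 pw|r].
    rewrite !LE (mono_perm _ pw); congr (_ - _); apply: eq_bigr => s _.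
    by rewrite (mono_perm _ pw).
  by rewrite /L !mono_nseq /k divfK ?expf_neq0 ?rigid_sum_neq0 // subrr mulr0.
have bw (s : seq letter) : size s = e -> mono b s = k q * mono (a q) s.
  move=> /eqP sz_s; have /eqP := L0 q (Tuple sz_s).
  by rewrite mulf_eq0 (negPf cq_neq0) subr_eq0 => /eqP.
have [i bi] : exists i, b i 0 != 0.
  apply/existsP; apply: contraNT b_neq0; rewrite negb_exists => /forallP b0.
  apply/eqP/matrixP => i j; rewrite (ord1 j) mxE; apply/eqP.
  by have := b0 i; rewrite negbK.
have := bw (nseq e (Some i)); rewrite size_nseq !mono_nseq !letter_form_some.
move=> /(_ erefl) bie.
have kq : k q * a q i 0 ^+ e != 0 by rewrite -bie expf_neq0.
have ai : a q i 0 != 0.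
  by move: kq; rewrite mulf_eq0 expf_eq0 e_gt0 negb_or => /andP[].
clear L LE L0; move: {+}(k q) bw bie {kq} => {}k bw bie.
exists (b i 0 / a q i 0); apply/matrixP => j z; rewrite (ord1 z) {z} mxE.
have := bw (Some j :: nseq e.-1 (Some i)); rewrite /= size_nseq prednK //.
move=> /(_ erefl); rewrite [mono b _]big_cons [mono (a q) _]big_cons.
rewrite [X in _ * X = _]mono_nseq [X in _ * (_ * X)]mono_nseq.
rewrite !letter_form_some => bj.
apply: (mulIf (expf_neq0 e.-1 bi)); rewrite bj.
have -> : b i 0 / a q i 0 * a q j 0 * b i 0 ^+ e.-1 =
    a q j 0 / a q i 0 * b i 0 ^+ e.
  by rewrite -[in RHS](prednK e_gt0) exprS mulrA; congr (_ * _);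
     rewrite mulrAC [RHS]mulrAC [b i 0 * _]mulrC.
rewrite bie -[in RHS](prednK e_gt0) exprS [RHS]mulrCA.
by rewrite [_ / _ * (_ * _)]mulrA divfK.
Qed.

End Rigidity.

(** * The points e_i + e_j *)

Local Notation pair_index n := {p : 'I_n * 'I_n | (p.1 < p.2)%N}.

Section PairConfiguration.
Variables (F : numFieldType).

Definition pair_point n (q : pair_index n) : 'cV[F]_n :=
  delta_mx (val q).1 0 + delta_mx (val q).2 0.

Lemma card_pair_index n : #|{: pair_index n}| = ((n ^ 2 - n) %/ 2)%N.
Proof.
rewrite card_sub -sum1_card.
rewrite (eq_bigl (fun p : 'I_n * 'I_n => true && (p.1 < p.2)%N)) //.
rewrite -(pair_big_dep xpredT (fun i j : 'I_n => (i < j)%N)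
  (fun _ _ => 1%N)) /=.
rewrite (exchange_big_dep xpredT) //=.
under eq_bigr => j _.
  rewrite (big_ord_narrow (ltnW (ltn_ord j))) sum1_card card_ord; over.
rewrite -(big_mkord xpredT id) bin2_sum bin2 divn2 -subn1 mulnBr muln1.
by [].
Qed.

Variable e : nat.
Local Notation letter := (option 'I_e.+1).

Lemma pair_pointE (q : pair_index e.+1) i :
  pair_point q i 0 = ((i == (val q).1) || (i == (val q).2))%:R.
Proof.
rewrite !mxE !eqxx !andbT; case: eqP => [->|_] /=; last by rewrite add0r.
have := valP q; case: eqP => [->|_ _]; first by rewrite ltnn.
by rewrite addr0.
Qed.

Lemma pair_point_sum (q : pair_index e.+1) :
  letter_form (pair_point q) None = 2.
Proof.
have delta_sum (i : 'I_e.+1) : \sum_j (delta_mx i 0 : 'cV[F]_e.+1) j 0 = 1.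
  rewrite (bigD1 i) //= mxE !eqxx big1 ?addr0 // => j /negPf ne_ji.
  by rewrite mxE ne_ji.
rewrite letter_form_none; under eq_bigr do rewrite mxE.
by rewrite big_split /= !delta_sum.
Qed.

(** The contraction satisfies the hypotheses of [word_functional_eq0]: twice the
square of a coordinate of a point e_i + e_j is the product of this coordinate
and of the sum of the coordinates, which is 2.  As L q w is the value of the
contraction at x_i x_j w when q is the pair (i, j), it vanishes too. *)
Lemma rigid_pair_point : rigid e (@pair_point e.+1).
Proof.
move=> L sL L0.
pose f (s : seq letter) : F := if s is l :: l' :: m then
  if insub m is Some w then contraction (@pair_point e.+1) L l l' w else 0
  else 0.
have fE l l' m (sz_m : size m == e) :
    f (l :: l' :: m) =
    contraction (@pair_point e.+1) L l l' (Tuple sz_m).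
  by rewrite /f insubT.
clearbody f.
have f0 s : size s = e.+2 -> f s = 0.
  apply: word_functional_eq0.
  - case=> [|l1 [|l1' m1]] [|l2 [|l2' m2]] //= /eqP; rewrite ?eqSS.
    + by move=> _ /perm_size.
    + by move=> _ /perm_size.
    + move=> sz1 pm; have /eqP := perm_size pm; rewrite /= !eqSS (eqP sz1).
      rewrite eq_sym => sz2.
      by rewrite (fE _ _ _ sz1) (fE _ _ _ sz2); apply: sL.
  - move=> [|l m] //= /eqP; rewrite eqSS => sz_m.
    under eq_bigr do rewrite (fE _ _ _ sz_m).
    rewrite (fE _ _ _ sz_m) /contraction exchange_big /=.
    apply: eq_bigr => q _; rewrite -mulr_suml -mulr_sumr letter_form_none.
    by under [in RHS]eq_bigr do rewrite letter_form_some.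
  - move=> i m /eqP sz_m; rewrite !(fE _ _ _ sz_m) /contraction.
    rewrite -sumrMnl; apply: eq_bigr => q _.
    rewrite pair_point_sum letter_form_some pair_pointE.
    by case: (_ || _); rewrite ?mulr1 ?mulr0 ?mul0r ?mul0rn // mulr_natr.
  - move=> l l'; rewrite (fE _ _ _ (valP (nseq_tuple e None))) /contraction.
    apply: big1 => q _.
    by rewrite (_ : Tuple _ = nseq_tuple e None) ?L0 ?mul0r //; apply: val_inj.
move=> q w; have := f0 (Some (val q).1 :: Some (val q).2 :: w).
rewrite /= size_tuple (fE _ _ _ (valP w)) => /(_ erefl) <-.
rewrite (_ : Tuple _ = w); last exact: val_inj.
rewrite /contraction (bigD1 q) //= big1 ?addr0 => [|r ne_rq].
  by rewrite !letter_form_some !pair_pointE !eqxx orbT !mulr1.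
rewrite !letter_form_some !pair_pointE -mulrA -natrM mulnb.
set hit := (_ && _); suff -> : hit = false by rewrite mulr0.
apply: contraNF ne_rq => {f0}; rewrite {}/hit => qr; apply/eqP/esym/val_inj.
case: q r qr => [[i j] /= ij] [[i' j'] /= ij'].
case/andP=> /orP[] /eqP ii /orP[] /eqP jj; move: ij ij'; rewrite ii jj //.
- by rewrite ltnn.
- by move=> /ltn_trans lt /lt; rewrite ltnn.
- by rewrite ltnn.
Qed.

End PairConfiguration.

(** * From squares to decompositions *)

Section Uniqueness.
Variables (F : fieldType) (I K : nat).
Implicit Types (a b : 'cV[F]_I) (c d : 'cV[F]_K) (T t : tensor F I K).

Lemma outer_sq a c k : outer a a c k = c k 0 *: (a *m a^T).
Proof.
apply/matrixP => i j; rewrite ffunE !mxE big_ord1 !mxE mulrC.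
by rewrite mulrA.
Qed.

Lemma outerZ x a c : outer (x *: a) (x *: a) c = outer a a (x ^+ 2 *: c).
Proof.
apply/ffunP => k; rewrite !outer_sq mxE linearZ /= -scalemxAl -scalemxAr.
by rewrite !scalerA expr2 [_ * x]mulrC [_ * x]mulrC mulrA.
Qed.

Lemma rank1_family m (s : m.-tuple (tensor F I K)) :
    (forall t, t \in tval s -> is_rank1_SFS t) ->
  exists b : 'I_m -> 'cV[F]_I, exists d : 'I_m -> 'cV[F]_K,
    forall i, b i != 0 /\ tnth s i = outer (b i) (b i) (d i).
Proof.
move=> s1.
have /fin_all_exists[bd bdP] : forall i : 'I_m, exists bd : 'cV[F]_I * 'cV[F]_K,
    bd.1 != 0 /\ tnth s i = outer bd.1 bd.1 bd.2.
  move=> i; have [b [d [b0 _ sE]]] := s1 _ (mem_tnth i s).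
  by exists (b, d).
by exists (fun i => (bd i).1), (fun i => (bd i).2).
Qed.

Variables (R : nat) (A : 'M[F]_(I, R)) (C : 'M[F]_(K, R)) (D : 'M[F]_(R, K)).
Let sq r := col r A *m (col r A)^T.
Hypothesis A_indep : forall x : 'I_R -> F,
  \sum_r x r *: sq r = 0 -> forall r, x r = 0.
Hypothesis A_rank1 : forall b (x : 'I_R -> F),
  b != 0 -> b *m b^T = \sum_r x r *: sq r -> exists r k, b = k *: col r A.
Hypothesis CK : D *m C = 1%:M.

Let T := cpd A A C.
Let terms := [tuple outer (col r A) (col r A) (col r C) | r < R].

Let T_slice k : T k = \sum_r C k r *: sq r.
Proof.
rewrite /T /cpd sum_ffunE; apply: eq_bigr => r _.
by rewrite outer_sq mxE.
Qed.

Let vsq : 'M[F]_(R, I * I) := \matrix_r mxvec (sq r).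

Let vsq_free : row_free vsq.
Proof.
apply: inj_row_free => v v0; apply/rowP => r; rewrite mxE.
apply: (A_indep (x := v 0)); apply: (can_inj mxvecK).
rewrite linear0 -v0 mulmx_sum_row linear_sum; apply: eq_bigr => s _.
by rewrite linearZ rowK.
Qed.

Let colA_neq0 r : col r A != 0.
Proof.
apply/eqP => A0.
suff /A_indep/(_ r)/eqP : \sum_s ((s == r)%:R : F) *: sq s = 0.
  by rewrite eqxx oner_eq0.
apply: big1 => s _; have [->|_] := eqVneq s r; last by rewrite scale0r.
by rewrite /sq A0 mul0mx scaler0.
Qed.

Let colC_neq0 r : col r C != 0.
Proof.
apply/eqP => C0; have /matrixP/(_ r r)/eqP := CK.
rewrite mxE big1 => [|k _]; first by rewrite mxE eqxx eq_sym oner_eq0.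
by have /colP/(_ k) := C0; rewrite !mxE => ->; rewrite mulr0.
Qed.

Let sum_tuple m (s : m.-tuple (tensor F I K)) :
  \sum_(t <- s) t = \sum_i tnth s i.
Proof. by rewrite big_tuple. Qed.

Let terms_decomposition : SFS_decomposition T terms.
Proof.
split=> [t /tnthP[r ->]|]; last first.
  by rewrite sum_tuple; apply: eq_bigr => r _; rewrite tnth_mktuple.
by rewrite tnth_mktuple; exists (col r A), (col r C).
Qed.

Section Decomposition.
Variables (m : nat) (s : m.-tuple (tensor F I K)).
Variables (b : 'I_m -> 'cV[F]_I) (d : 'I_m -> 'cV[F]_K).
Hypotheses (sE : forall i, tnth s i = outer (b i) (b i) (d i)).
Hypothesis Ts : T = \sum_(t <- s) t.

Let vb : 'M[F]_(m, I * I) := \matrix_i mxvec (b i *m (b i)^T).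
Let E : 'M[F]_(R, m) := \matrix_(r, i) \sum_k D r k * d i k 0.

(** Applying D to the slices recovers the squares of the columns of A from the
first expression of T, and combinations of the squares of the b i from the
second one. *)
Let vsqE : vsq = E *m vb.
Proof.
apply/row_matrixP => r; rewrite row_mul rowK mulmx_sum_row.
have -> : sq r = \sum_k D r k *: T k.
  under eq_bigr => k _ do rewrite T_slice scaler_sumr.
  rewrite exchange_big /= (bigD1 r) //= [X in _ + X]big1 => [|r' ne_r].
    rewrite addr0; under eq_bigr => k _ do rewrite scalerA.
    rewrite -scaler_suml; have /matrixP/(_ r r) := CK.
    by rewrite !mxE eqxx => ->; rewrite scale1r.
  under eq_bigr => k _ do rewrite scalerA.
  rewrite -scaler_suml; have /matrixP/(_ r r') := CK.
  by rewrite !mxE eq_sym (negPf ne_r) => ->; rewrite scale0r.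
rewrite Ts sum_tuple; under eq_bigr => k _ do
  rewrite sum_ffunE scaler_sumr.
rewrite exchange_big linear_sum; apply: eq_bigr => i _ /=.
rewrite !mxE rowK scaler_suml linear_sum; apply: eq_bigr => k _.
by rewrite sE outer_sq scalerA linearZ.
Qed.

Lemma decomposition_size : (R <= m)%N.
Proof.
rewrite -(eqP vsq_free) vsqE (leq_trans (mxrankM_maxr _ _)) //.
exact: rank_leq_row.
Qed.

(* With as many terms as columns, E is invertible. *)
Let span_sq (eq_mR : m = R) i : exists x : 'I_R -> F,
  b i *m (b i)^T = \sum_r x r *: sq r.
Proof.
have E_full : row_full E.
  have : (R <= \rank E)%N by rewrite -{1}(eqP vsq_free) vsqE mxrankM_maxl.
  by rewrite -{1}eq_mR /row_full eqn_leq rank_leq_col.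
have [G GE] := row_fullP E_full.
exists (G i); apply: (can_inj mxvecK).
transitivity (row i (G *m vsq)); first by rewrite vsqE mulmxA GE mul1mx rowK.
rewrite row_mul mulmx_sum_row linear_sum; apply: eq_bigr => r _.
by rewrite linearZ rowK mxE.
Qed.

(** Every b i is a multiple of some column g i of A, and the multiple can be
moved to the last factor, as c i.  By independence of the squares, the column r
of C is the sum of the c i with g i = r; as it is not zero, g is onto, hence a
bijection, and the terms agree. *)
Lemma decomposition_perm (b_neq0 : forall i, b i != 0) :
  m = R -> perm_eq terms s.
Proof.
move=> eq_mR.
have /fin_all_exists[rk rkP] : forall i : 'I_m, exists rk : 'I_R * F,
    b i = rk.2 *: col rk.1 A.
  move=> i; have [x bx] := span_sq eq_mR i.
  by have [r [k ->]] := A_rank1 (b_neq0 i) bx; exists (r, k).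
pose g i := (rk i).1; pose c i := (rk i).2 ^+ 2 *: d i.
have sg i : tnth s i = outer (col (g i) A) (col (g i) A) (c i).
  by rewrite sE rkP outerZ.
have Cg r : col r C = \sum_(i | g i == r) c i.
  apply/colP => k; rewrite mxE summxE; apply/eqP; rewrite -subr_eq0; apply/eqP.
  apply: (A_indep (x := fun r => C k r - \sum_(i | g i == r) c i k 0)).
  under eq_bigr do rewrite scalerBl.
  rewrite sumrB -T_slice Ts sum_tuple sum_ffunE.
  rewrite (partition_big g xpredT) //= -sumrB; apply: big1 => r' _.
  rewrite scaler_suml -sumrB; apply: big1 => i /eqP gi.
  by rewrite sg outer_sq gi subrr.
have g_surj r : exists i, g i = r.
  suff /existsP[i /eqP gi] : [exists i, g i == r] by exists i.
  apply: contraNT (colC_neq0 r); rewrite negb_exists => /forallP g_r.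
  by rewrite Cg big1 // => i gi; have := g_r i; rewrite gi.
have [h gh] := fin_all_exists g_surj.
have h_bij : bijective h.
  by apply: inj_card_bij (can_inj gh) _; rewrite !card_ord eq_mR.
have g_inj : injective g := bij_inj (bij_can_bij h_bij gh).
have terms_h r : tnth terms r = tnth s (h r).
  rewrite tnth_mktuple sg gh Cg (bigD1 (h r)) ?gh //= big1 ?addr0 // => i.
  by rewrite -{1}(gh r) (inj_eq g_inj) => /andP[->].
have -> : tval s = map (tnth s) (enum 'I_m) by rewrite map_tnth_enum.
have -> : tval terms = map (tnth s) (map h (enum 'I_R)).
  rewrite -map_comp -[LHS]map_tnth_enum; exact: eq_map.
apply: perm_map; apply: uniq_perm => [||i]; rewrite ?enum_uniq //.
  by rewrite map_inj_uniq ?enum_uniq //; exact: can_inj gh.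
rewrite mem_enum inE; have [h' _ hh'] := h_bij.
by apply/mapP; exists (h' i); rewrite ?mem_enum ?hh'.
Qed.

End Decomposition.

(** Any decomposition has at least R terms, so the given one is minimal, and
any other minimal one has R terms. *)
Lemma SFS_CPD_unique_cpd : SFS_CPD_unique T.
Proof.
have size_ge s : SFS_decomposition T s -> (R <= size s)%N.
  move=> [s1 Ts]; have [b [d bd]] := rank1_family (s := in_tuple s) s1.
  exact: (decomposition_size (s := in_tuple s) (fun i => (bd i).2) Ts).
have terms_CPD : SFS_CPD T terms.
  split; first exact: terms_decomposition.
  split; first by exists terms => //; exact: terms_decomposition.
  by rewrite size_tuple.
exists terms => // s [dec_s [_ s_min]].
have eq_sR : size s = R.
  apply/eqP; rewrite eqn_leq size_ge // andbT.
  by have := s_min _ terms_decomposition; rewrite size_tuple.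
have [s1 Ts] := dec_s; have [b [d bd]] := rank1_family (s := in_tuple s) s1.
exact: (decomposition_perm (s := in_tuple s) (fun i => (bd i).2) Ts
          (fun i => (bd i).1) eq_sR).
Qed.

End Uniqueness.

(** * Zero sets of polynomial functions *)

Section SigmaFiniteTupleMeasure.
Local Open Scope classical_set_scope.
Local Open Scope ereal_scope.

(** Product measures are built as bare set functions, whereas theorems on
integration are about bundled measures: each of them is shown to be equal to
one of the latter. *)
Lemma sigma_finite_measureE d (T : measurableType d) (R : realType)
    (m : {measure set T -> \bar R}) : sigma_finite setT m ->
  exists m' : {sigma_finite_measure set T -> \bar R},
    (m : set T -> \bar R) = m'.
Proof.
pose p := Measure.sort m; rewrite -/p.
have p0 : p set0 = 0 by exact: measure0.
have p_ge0 A : 0 <= p A by exact: measure_ge0.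
have p_add : semi_sigma_additive p by exact: measure_semi_sigma_additive.
move=> p_fin; clearbody p.
pose p1 := isMeasure.Build _ _ _ p p0 p_ge0 p_add.
pose p_measure : {measure set T -> \bar R} := HB.pack p p1.
pose p2 := Measure_isSigmaFinite.Build _ _ _ p_measure p_fin.
pose m' : {sigma_finite_measure set T -> \bar R} := HB.pack p p1 p2.
by exists m'.
Qed.

Lemma product_measure_sigma_finite d1 d2 (T1 : measurableType d1)
    (T2 : measurableType d2) (R : realType)
    (m1 : {sigma_finite_measure set T1 -> \bar R})
    (m2 : {sigma_finite_measure set T2 -> \bar R}) :
  exists m : {sigma_finite_measure set (T1 * T2)%type -> \bar R}, m1 \x m2 = m.
Proof.
apply: sigma_finite_measureE.
have [F FT Ffin] := sigma_finiteT m1; have [G GT Gfin] := sigma_finiteT m2.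
exists (fun n => if unpickle n is Some ij then F ij.1 `*` G ij.2 else set0).
  apply/seteqP; split=> // -[x y] _.
  have [i _ Fx] : (\bigcup_i F i) x by rewrite -FT.
  have [j _ Gy] : (\bigcup_i G i) y by rewrite -GT.
  by exists (pickle (i, j)) => //; rewrite pickleK.
move=> n; case: unpickle => [[i j]|] /=; last by rewrite measure0.
have [[mF Fy] [mG Gy]] := (Ffin i, Gfin j); split; first exact: measurableX.
by rewrite product_measure1E // lte_mul_pinfty // ge0_fin_numE.
Qed.

(** The left inverse k carries a covering by sets of finite measure along h. *)
Lemma pushforward_sigma_finite d1 d2 (T1 : measurableType d1)
    (T2 : measurableType d2) (R : realType)
    (m : {sigma_finite_measure set T1 -> \bar R})
    (h : T1 -> T2) (k : T2 -> T1) :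
    measurable_fun setT h -> measurable_fun setT k -> cancel h k ->
  exists m' : {sigma_finite_measure set T2 -> \bar R}, pushforward m h = m'.
Proof.
move=> mh mk hk.
have [F FT Ffin] := sigma_finiteT m.
suff p_fin : sigma_finite setT (pushforward m h).
  exact: (@sigma_finite_measureE _ _ _ (pushforward m h)).
exists (fun i => k @^-1` F i).
  by rewrite -preimage_bigcup -FT preimage_setT.
move=> i; have [mF Fy] := Ffin i; split.
  by rewrite -[X in measurable X]setTI; exact: mk.
rewrite [X in X < _](_ : _ = m (F i)) //; congr (m _).
by apply/funext => x /=; rewrite /preimage /= hk.
Qed.

Context d (T : measurableType d) (R : realType).
Variable mu : {sigma_finite_measure set T -> \bar R}.

Lemma measurable_tuple_cons n :
  measurable_fun setT (fun p : T * n.-tuple T => [tuple of p.1 :: p.2]).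
Proof. exact: measurable_cons. Qed.

Lemma tuple_measure_sigma_finite n :
  exists m : {sigma_finite_measure set (n.-tuple T) -> \bar R},
    tuple_measure mu n = m.
Proof.
elim: n => [|n [m mE]] /=; first by exists (dirac [tuple]).
have [mm mmE] := product_measure_sigma_finite mu m.
rewrite mE mmE; apply: (@pushforward_sigma_finite _ _ _ _ _ mm _
  (fun t : n.+1.-tuple T => (thead t, [tuple of behead t]))).
- exact: measurable_tuple_cons.
- by apply: measurable_fun_pair;
    [exact: measurable_tnth|exact: measurable_behead].
- by move=> [x t] /=; congr (_, _); apply: val_inj.
Qed.

End SigmaFiniteTupleMeasure.

Lemma poly_roots_seq (F : fieldType) (p : {poly F}) :
  p != 0 -> exists s : seq F, forall z, root p z -> z \in s.
Proof.
have [k] := ubnP (size p); elim: k p => // k IHk p le_k p0.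
have [[z0 pz0]|no_root] := pselect (exists z, root p z); last first.
  by exists [::] => z pz; case: no_root; exists z.
have [q pq] := factor_theorem _ _ pz0.
have q0 : q != 0 by apply: contraNneq p0 => q0; rewrite pq q0 mul0r.
have [|s qs] := IHk q _ q0.
  by move: le_k; rewrite pq size_Mmonic ?monicXsubC // size_XsubC addn2 ltnS.
exists (z0 :: s) => z; rewrite pq rootM root_XsubC inE orbC.
by case/orP => [->//|/qs ->]; rewrite orbT.
Qed.

Definition mx_coord (F : Type) m n (ij : 'I_m * 'I_n) (A : 'M[F]_(m, n)) : F :=
  A ij.1 ij.2.

(** A field F with coordinates in a measurable space T: the case of the complex
numbers is that of their real and imaginary parts. *)
Section ZeroSets.
Local Open Scope classical_set_scope.
Context d (T : measurableType d) (R : realType) (F : fieldType).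
Variable mu : {sigma_finite_measure set T -> \bar R}.
Variables (f : T -> F) (g : F -> T).
Hypotheses (fK : cancel f g) (gK : cancel g f).
Hypothesis measurable_addf :
  measurable_fun setT (fun p : T * T => g (f p.1 + f p.2)).
Hypothesis measurable_mulf :
  measurable_fun setT (fun p : T * T => g (f p.1 * f p.2)).
Hypothesis measurable_point : forall x : T, measurable [set x].
Hypothesis mu_point : forall x : T, mu [set x] = 0%E.

Definition tuple_coord n (i : 'I_n) (t : n.-tuple T) : F := f (tnth t i).

Lemma polyfun_measurable n (P : n.-tuple T -> F) :
  polyfun (@tuple_coord n) P -> measurable_fun setT (g \o P).
Proof.
elim=> {P} [c|i|P Q _ mP _ mQ|P Q _ mP _ mQ].
- exact: measurable_cst.
- rewrite [_ \o _](_ : _ = (@tnth _ T)^~ i); first exact: measurable_tnth.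
  by apply/funext => t /=; rewrite /tuple_coord fK.
- rewrite [_ \o _](_ : _ = (fun p : T * T => g (f p.1 + f p.2)) \o
      (fun t => (g (P t), g (Q t)))); last by apply/funext => t /=; rewrite !gK.
  by apply: measurableT_comp => //; apply: measurable_fun_pair.
- rewrite [_ \o _](_ : _ = (fun p : T * T => g (f p.1 * f p.2)) \o
      (fun t => (g (P t), g (Q t)))); last by apply/funext => t /=; rewrite !gK.
  by apply: measurableT_comp => //; apply: measurable_fun_pair.
Qed.

Lemma measurable_zero_set n (P : n.-tuple T -> F) :
  polyfun (@tuple_coord n) P -> measurable [set t | P t = 0].
Proof.
move=> /polyfun_measurable mP.
rewrite [X in measurable X](_ : _ = setT `&` (g \o P) @^-1` [set g 0]).
  exact: mP.
rewrite setTI; apply/seteqP; split=> t /= [].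
  by move=> ->.
by move=> /(can_inj gK).
Qed.

Lemma negligible_seq (s : seq F) : mu.-negligible [set x | f x \in s].
Proof.
elim: s => [|z s IHs].
  rewrite [X in _.-negligible X](_ : _ = set0).
    by exists set0; split; rewrite ?measure0.
  by apply/seteqP; split.
rewrite [X in _.-negligible X](_ : _ = [set g z] `|` [set x | f x \in s]).
  apply: negligibleU IHs; exists [set g z].
  by split; [exact: measurable_point|exact: mu_point|].
apply/seteqP; split=> x /=; rewrite inE.
  by case/orP => [/eqP <-|]; [left; rewrite fK|right].
by case=> [->|->]; rewrite ?gK ?eqxx ?orbT.
Qed.

Lemma polyfun_univariate X J (x : J -> X -> F) (y : X -> F) P :
    (forall j, exists q : {poly F}, forall u, x j u = q.[y u]) ->
    polyfun x P -> exists p : {poly F}, forall u, P u = p.[y u].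
Proof.
move=> xq; elim=> {P} [c|j|P Q _ [p pP] _ [q qQ]|P Q _ [p pP] _ [q qQ]].
- by exists c%:P => u; rewrite hornerC.
- exact: xq.
- by exists (p + q) => u; rewrite hornerD pP qQ.
- by exists (p * q) => u; rewrite hornerM pP qQ.
Qed.

(** With t = x0 :: t1, the polynomial x |-> P (x :: t1) is not zero, so it
has finitely many roots; for any other x the function u |-> P (x :: u) is not
zero at t1.  By induction almost all sections of the zero set are null. *)
Lemma zero_set_null n (P : n.-tuple T -> F) t :
    polyfun (@tuple_coord n) P -> P t != 0 ->
  tuple_measure mu n [set t | P t = 0] = 0%E.
Proof.
elim: n P t => [|n IHn] P t pP Pt.
  rewrite /= diracE memNset // => /= P0; move: Pt.
  by rewrite (tuple0 t) P0 eqxx.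
have cons_poly x : polyfun (@tuple_coord n) (fun t => P [tuple of x :: t]).
  apply: (polyfun_comp (h := fun u : n.-tuple T => [tuple of x :: u]) _ pP).
  move=> i.
  have [j ->|->] := unliftP ord0 i; last first.
    exact: (eq_polyfun _ (polyfun_cst _ (f x))).
  apply: (eq_polyfun _ (polyfun_coord _ j)) => u.
  by rewrite /tuple_coord /= tnthS.
pose t1 := [tuple of behead t].
have [p pE] : exists p : {poly F}, forall x, P [tuple of x :: t1] = p.[f x].
  apply: (polyfun_univariate (x := fun i x => f (tnth [tuple of x :: t1] i))).
    move=> i; have [j ->|->] := unliftP ord0 i.
      by exists (f (tnth t1 j))%:P => x; rewrite hornerC tnthS.
    by exists 'X => x; rewrite hornerX.
  apply: (polyfun_comp (h := fun x => [tuple of x :: t1]) _ pP) => i.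
  exact: (polyfun_coord (fun i x => f (tnth [tuple of x :: t1] i)) i).
have p0 : p != 0.
  apply: contraNneq Pt => p0.
  by rewrite {1}(tuple_eta t) -/t1 pE p0 horner0.
have [s sP] := poly_roots_seq p0.
have [m mE] := tuple_measure_sigma_finite mu n.
pose Z := [set q : T * n.-tuple T | P [tuple of q.1 :: q.2] = 0].
have mZ : measurable Z.
  have := @measurable_tuple_cons _ T n measurableT _ (measurable_zero_set pP).
  by rewrite setTI.
rewrite /= mE /pushforward -/Z /product_measure1.
rewrite (ae_eq_integral (cst 0%E)) ?integral0 //.
  exact: measurable_fun_xsection.
apply: negligibleS (negligible_seq s) => x /=.
apply: contra_notT => fx_s _; rewrite -mE.
rewrite [xsection _ _](_ : _ = [set u : n.-tuple T | P [tuple of x :: u] = 0]).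
  apply: (IHn _ t1 (cons_poly x)); rewrite pE.
  by apply: contraNneq fx_s => /rootP/sP.
by apply/seteqP; split=> u; rewrite /xsection /= inE.
Qed.

Lemma polyfun_mx_null m n (P : 'M[F]_(m, n) -> F) A0 :
    polyfun (@mx_coord F m n) P -> P A0 != 0 ->
  measurable [set t | P (mx_of_tuple f t) = 0] /\
  tuple_measure mu (m * n) [set t | P (mx_of_tuple f t) = 0] = 0%E.
Proof.
move=> pP PA0.
have pPt : polyfun (@tuple_coord (m * n)) (P \o @mx_of_tuple _ T F f m n).
  apply: polyfun_comp pP => -[i j].
  apply: (eq_polyfun _ (polyfun_coord _ (mxvec_index i j))) => t.
  by rewrite /mx_coord /= mxE.
split; first exact: measurable_zero_set pPt.
apply: (zero_set_null (t := [tuple g (mxvec A0 0 k) | k < m * n]) pPt).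
rewrite /= [mx_of_tuple _ _](_ : _ = A0) //.
by apply/matrixP => i j; rewrite mxE tnth_mktuple mxvecE gK.
Qed.

Lemma mx2_null_polyfun m1 n1 m2 n2 (P : 'M[F]_(m1, n1) -> F)
    (Q : 'M[F]_(m2, n2) -> F) A0 C0 S :
    polyfun (@mx_coord F m1 n1) P -> P A0 != 0 ->
    polyfun (@mx_coord F m2 n2) Q -> Q C0 != 0 ->
    (forall A C, P A != 0 -> Q C != 0 -> ~ S (A, C)) ->
  mx2_null mu f S.
Proof.
move=> pP PA0 pQ QC0 good; rewrite /mx2_null.
have [mP P0] := polyfun_mx_null pP PA0; have [mQ Q0] := polyfun_mx_null pQ QC0.
move: P0 Q0; have [mA ->] := tuple_measure_sigma_finite mu (m1 * n1).
have [mC ->] := tuple_measure_sigma_finite mu (m2 * n2) => P0 Q0.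
set ZP := [set t | P _ = 0] in mP P0; set ZQ := [set t | Q _ = 0] in mQ Q0.
apply: (@negligibleS _ _ _ _ (ZP `*` setT `|` setT `*` ZQ)); last first.
  apply: negligibleU.
    exists (ZP `*` setT); split=> //; first exact: measurableX.
    by rewrite /= product_measure1E // [X in (X * _)%E]P0 mul0e.
  exists (setT `*` ZQ); split=> //; first exact: measurableX.
  by rewrite /= product_measure1E // [X in (_ * X)%E]Q0 mule0.
move=> [t u] /= Stu; apply: contrapT => /not_orP[nP nQ].
apply: good Stu; apply/eqP => z0; [apply: nP|apply: nQ]; split=> //; exact: z0.
Qed.

End ZeroSets.

(** * Generic matrices *)

Section GenericPoint.
Variable F : numFieldType.

Lemma sq_eq0 n (b : 'cV[F]_n) : b *m b^T = 0 -> b = 0.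
Proof.
move=> /matrixP b0; apply/matrixP => i j; rewrite (ord1 j) mxE.
by have /eqP := b0 i i; rewrite !mxE big_ord1 mxE mulf_eq0 orbb => /eqP.
Qed.

(** The columns of A replace the first r points of the configuration of all
e_i + e_j, the other points being kept; rigidity of the whole family is a
polynomial condition on A, satisfied when A consists of the replaced points. *)
Lemma generic_squares n r : (1 < n)%N -> (r <= (n ^ 2 - n) %/ 2)%N ->
  exists P A0, [/\ polyfun (@mx_coord F n r) P, P A0 != 0 &
    forall A, P A != 0 ->
    (forall x : 'I_r -> F,
       \sum_j x j *: (col j A *m (col j A)^T) = 0 -> forall j, x j = 0) /\
    (forall b (x : 'I_r -> F), b != 0 ->
       b *m b^T = \sum_j x j *: (col j A *m (col j A)^T) ->
       exists j k, b = k *: col j A)].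
Proof.
case: n => // e; rewrite ltnS => e_gt0; rewrite -card_pair_index => le_r.
pose Q : finType := {: pair_index e.+1}.
pose iota (j : 'I_r) : Q := enum_val (widen_ord le_r j).
have iota_inj : injective iota.
  by move=> j j' /enum_val_inj /(congr1 val) /= /val_inj.
pose a (A : 'M[F]_(e.+1, r)) (q : Q) :=
  if [pick j | iota j == q] is Some j then col j A else pair_point F q.
have a_iota A j : a A (iota j) = col j A.
  rewrite /a; case: pickP => [j' /eqP /iota_inj -> //|/(_ j)].
  by rewrite eqxx.
pose A0 : 'M[F]_(e.+1, r) := \matrix_(i, j) pair_point F (iota j) i 0.
have aA0 : a A0 = @pair_point F e.+1.
  apply/funext => q; rewrite /a; case: pickP => // j /eqP <-.
  by apply/matrixP => i z; rewrite (ord1 z) !mxE.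
have pa q i : polyfun (@mx_coord F e.+1 r) (fun A => a A q i 0).
  rewrite /a; case: pickP => [j _|_]; last exact: polyfun_cst.
  by apply: (eq_polyfun _ (polyfun_coord _ (i, j))) => A; rewrite mxE.
have [] := rigid_open (e := e) (u0 := A0) pa.
  by rewrite aA0; exact: rigid_pair_point.
move=> P [pP PA0 rigP]; exists P, A0; split=> // A /rigP a_rigid.
pose c (x : 'I_r -> F) q := \sum_(j | iota j == q) x j.
have cE x : \sum_j x j *: (col j A *m (col j A)^T) =
    \sum_q c x q *: (a A q *m (a A q)^T).
  rewrite (partition_big iota xpredT) //=; apply: eq_bigr => q _.
  rewrite scaler_suml; apply: eq_bigr => j /eqP <-.
  by rewrite a_iota.
have c_iota x j : c x (iota j) = x j.
  by rewrite /c (big_pred1 j) // => j'; rewrite /= (inj_eq iota_inj).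
split=> [x|b x b_neq0]; rewrite cE.
  by move=> /(rigid_indep a_rigid e_gt0 ord0) x0 j; rewrite -c_iota x0.
move=> bE; have rank1 := rigid_rank1 a_rigid e_gt0 ord0 bE.
have [[q cq]|c0] := pselect (exists q, c x q != 0); last first.
  case/eqP: b_neq0; apply: sq_eq0; rewrite bE big1 // => q _.
  have [->|cq] := eqVneq (c x q) 0; first by rewrite scale0r.
  by case: c0; exists q.
have [j /eqP jq] : exists j, iota j == q.
  apply/existsP; apply: contraNT cq; rewrite negb_exists => /forallP no_j.
  by rewrite /c big1 // => j jq; have := no_j j; rewrite jq.
by have [k bk] := rank1 q cq; exists j, k; rewrite bk -jq a_iota.
Qed.

Lemma generic_left_inverse m r : (r <= m)%N ->
  exists P C0, [/\ polyfun (@mx_coord F m r) P, P C0 != 0 &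
    forall C, P C != 0 -> exists D, D *m C = 1%:M].
Proof.
move=> le_rm; pose E : 'M[F]_(r, m) := pid_mx r.
exists (fun C => \det (E *m C)), (pid_mx r); split.
- apply: polyfun_det; apply: polyfun_mulmx => i j; first exact: polyfun_cst.
  exact: (polyfun_coord _ (i, j)).
- by rewrite pid_mx_id // pid_mx_1 det1 oner_eq0.
move=> C EC; exists (invmx (E *m C) *m E).
by rewrite -mulmxA mulVmx // unitmxE unitfE.
Qed.

End GenericPoint.

Section GenericUniqueness.
Local Open Scope classical_set_scope.
Context d (T : measurableType d) (R : realType) (F : numFieldType).
Variable mu : {sigma_finite_measure set T -> \bar R}.
Variables (f : T -> F) (g : F -> T).
Hypotheses (fK : cancel f g) (gK : cancel g f).
Hypothesis measurable_addf :
  measurable_fun setT (fun p : T * T => g (f p.1 + f p.2)).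
Hypothesis measurable_mulf :
  measurable_fun setT (fun p : T * T => g (f p.1 * f p.2)).
Hypothesis measurable_point : forall x : T, measurable [set x].
Hypothesis mu_point : forall x : T, mu [set x] = 0%E.

Lemma SFS_CPD_generically_unique n m r :
    (1 < n)%N -> (r <= m)%N -> (r <= (n ^ 2 - n) %/ 2)%N ->
  SFS_CPD_generically_unique_for mu f n m r.
Proof.
move=> n_gt1 le_rm le_r.
have [P [A0 [pP PA0 goodA]]] := generic_squares F n_gt1 le_r.
have [Q [C0 [pQ QC0 goodC]]] := generic_left_inverse F le_rm.
apply: (mx2_null_polyfun fK gK measurable_addf measurable_mulf
  measurable_point mu_point pP PA0 pQ QC0) => A C PA QC /=; apply.
have [indep rank1] := goodA A PA; have [D DC] := goodC C QC.
exact: (SFS_CPD_unique_cpd indep rank1 DC).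
Qed.

End GenericUniqueness.

Lemma generically_unique_real (R : realType) n m r :
    (1 < n)%N -> (r <= m)%N -> (r <= (n ^ 2 - n) %/ 2)%N ->
  SFS_CPD_generically_unique_real R n m r.
Proof.
move=> n_gt1 le_rm le_r.
apply: (@SFS_CPD_generically_unique _ _ R R (@lebesgue_measure R) _ id) => //.
- by apply: measurable_funD; [exact: measurable_fst|exact: measurable_snd].
- by apply: measurable_funM; [exact: measurable_fst|exact: measurable_snd].
- by move=> x; exact: lebesgue_measure_set1.
Qed.

Local Open Scope classical_set_scope.

Lemma set1_pair (X Y : Type) (x : X * Y) : [set x] = [set x.1] `*` [set x.2].
Proof. by case: x => x y; apply/seteqP; split=> -[u v] /= [-> ->]. Qed.

Lemma generically_unique_complex (R : realType) n m r :
    (1 < n)%N -> (r <= m)%N -> (r <= (n ^ 2 - n) %/ 2)%N ->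
  SFS_CPD_generically_unique_complex R n m r.
Proof.
move=> n_gt1 le_rm le_r; rewrite /SFS_CPD_generically_unique_complex.
have [mu2 mu2E] :=
  product_measure_sigma_finite (@lebesgue_measure R) (@lebesgue_measure R).
have mu2_point x : mu2 [set x] = 0%E.
  rewrite -mu2E set1_pair product_measure1E //.
  by rewrite [X in (X * _)%E]lebesgue_measure_set1 mul0e.
rewrite mu2E.
apply: (@SFS_CPD_generically_unique _ _ R R[i] mu2 _
  (fun z => (complex.Re z, complex.Im z))) => //.
- by case.
- by case.
- by apply: measurable_fun_pair; apply: measurable_funD;
    exact: measurableT_comp.
- apply: measurable_fun_pair; [apply: measurable_funB|apply: measurable_funD];
    by apply: measurable_funM; exact: measurableT_comp.
- by move=> x; rewrite set1_pair; exact: measurableX.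
Qed.

Theorem proposition1p11 (R : realType) (I K Rk : nat)
    (I_ge4 : (4 <= I)%N) (I_lt_Rk : (I < Rk)%N) (Rk_le_K : (Rk <= K)%N)
    (Rk_le : (Rk <= (I ^ 2 - I) %/ 2)%N) :
  SFS_CPD_generically_unique_real R I K Rk /\
  SFS_CPD_generically_unique_complex R I K Rk.
Proof.
have I_gt1 : (1 < I)%N by apply: leq_trans I_ge4.
split; first exact: generically_unique_real.
exact: generically_unique_complex.
Qed.
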